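(* Let $G$ be an infinite Abelian group. Then $G$ has a proper subgroup $H \subsetneq G$ with $|H| = |G|$ if and only if $G$ is not a Prüfer group.
   Context: $|X|$ denotes the cardinality of a set $X$ (working in ZFC). A Prüfer group is a group isomorphic to $\mathbb{Z}(p^{\infty}) = \mathbb{Z}[1/p]/\mathbb{Z}$ for some prime number $p$. *)

(* Defs.v *)
From HB Require Import structures.
From mathcomp Require Import all_boot all_order all_algebra.
From mathcomp Require Import all_classical.

Set Implicit Arguments.
Unset Strict Implicit.
Unset Printing Implicit Defensive.

Import Order.TTheory GRing.Theory Num.Theory.
Local Open Scope ring_scope.

(* Z[1/p] as a subset of Q. The parameter p ranges over all of nat so that the
   group structures below need no primality argument; p = 0 gives Z, since
   0^-1 = 0 in rat. *)
Definition zinv_pred (p : nat) : rat -> bool :=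
  fun x => `[< exists (a : int) (n : nat), x = a%:~R / p%:R ^+ n >].

Fact zinv_zmod_closed p : zmod_closed (zinv_pred p).
Proof.
split; first by apply/asboolP; exists 0, 0%N; rewrite mul0r.
move=> x y /asboolP[a [n ->]] /asboolP[b [m ->]]; apply/asboolP.
have [p0|p0] := eqVneq (p%:R : rat) 0.
  rewrite p0; case: n m => [|n] [|m]; rewrite ?exprS ?mul0r ?invr0 ?mulr0.
  - by exists (a - b), 0%N; rewrite rmorphB !expr0 invr1 !mulr1.
  - by exists a, 0%N; rewrite subr0.
  - by exists (- b), 0%N; rewrite rmorphN sub0r mulNr.
  - by exists 0, 0%N; rewrite subr0 mul0r.
exists (a * p%:R ^+ m - b * p%:R ^+ n), (n + m)%N.
rewrite -mulNr addf_div ?expf_neq0 // exprD mulNr.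
by rewrite rmorphB !rmorphM !rmorphXn /= !rmorph_nat.
Qed.

HB.instance Definition _ p :=
  GRing.isZmodClosed.Build rat (zinv_pred p) (zinv_zmod_closed p).

Definition zinv (p : nat) := {x : rat | zinv_pred p x}.
HB.instance Definition _ p := SubChoice.on (zinv p).
HB.instance Definition _ p := [SubChoice_isSubZmodule of zinv p by <:].

Definition zinv_int (p : nat) : zinv p -> bool :=
  fun x => val x \is a Num.int.

Fact zinv_int_zmod_closed p : zmod_closed (@zinv_int p).
Proof.
split=> [|x y]; rewrite !unfold_in /zinv_int ?raddf0 ?raddfB /= ?rpred0 //.
exact: rpredB.
Qed.

HB.instance Definition _ p :=
  GRing.isZmodClosed.Build (zinv p) (@zinv_int p) (@zinv_int_zmod_closed p).

(* Z(p^oo) = Z[1/p] / Z *)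
Definition Zpoo (p : nat) : zmodType :=
  Quotient.quot (GRing.ZmodClosed.clone (zinv p) (@zinv_int p) _).

Definition is_Prufer (G : zmodType) : Prop :=
  exists2 p : nat, prime p & exists f : {additive G -> Zpoo p}, bijective f.

(* Main.v *)
Require Import Defs.
From HB Require Import structures.
From mathcomp Require Import all_boot all_order all_algebra.
From mathcomp Require Import all_classical.
From mathcomp Require Import zify.

Set Implicit Arguments.
Unset Strict Implicit.
Unset Printing Implicit Defensive.

Import Order.TTheory GRing.Theory Num.Theory.
Local Open Scope classical_set_scope.
Local Open Scope card_scope.
Local Open Scope ring_scope.

(* Suppose every proper subgroup of the infinite group G is smaller than G. A
   proper subgroup M of countable index must be finite, since an infinite M
   would satisfy |G| <= |M x N| = |M|. If pG <> G for some prime p, then some M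
   containing pG has index p, which is absurd; so G is divisible. A nonzero
   element lies in a countable divisible subgroup, which has a complement M;
   hence M is finite and G is countable, so that now every proper subgroup of G
   is finite. Then G is torsion, and starting from an element X_1 of prime order
   p one divides repeatedly, p X_(n+1) = X_n; the X_n generate an infinite
   subgroup, i.e. G, and a / p^n |-> a X_n induces Z[1/p] / Z = G. Conversely, a
   subgroup of Z(p^oo) missing X_n lies in the cyclic group generated by X_n. *)

(** * Subgroups given by predicates, and countable closures *)

(** Allows subgroups to be introduced by [Prop]-valued, typically existential, conditions. *)
Lemma zmodClosed_of_set (G : zmodType) (A : set G) :
  A 0 -> (forall x y, A x -> A y -> A (x - y)) ->
  exists H : zmodClosed G, forall x, x \in H <-> A x.
Proof.
move=> A0 AB.
have cA : zmod_closed (fun x => `[< A x >]).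
  split; first exact/asboolP.
  by move=> x y /asboolP Ax /asboolP Ay; apply/asboolP/AB.
pose mix := GRing.isZmodClosed.Build G (fun x => `[< A x >]) cA.
pose H : zmodClosed G := HB.pack (fun x => `[< A x >]) mix.
by exists H => x; split=> /asboolP.
Qed.

(** [GenTree.tree nat] serves as a ready-made countable syntax of terms; ill-formed trees evaluate
    to 0, which puts 0 in the range. *)
Fixpoint tree_eval (G : zmodType) (s : nat -> G) (h : nat -> G -> G)
    (t : GenTree.tree nat) : G :=
  match t with
  | GenTree.Leaf k => s k
  | GenTree.Node 0 [:: a; b] => tree_eval s h a - tree_eval s h b
  | GenTree.Node n.+1 [:: a] => h n (tree_eval s h a)
  | _ => 0
  end.

(* The closure is the image of the countable type of terms built from s, h and
   subtraction. *)
Lemma countable_closure (G : zmodType) (s : nat -> G) (h : nat -> G -> G) :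
  exists D : zmodClosed G, [/\ countable [set` D], forall n, s n \in D
    & forall n x, x \in D -> h n x \in D].
Proof.
have [||D DP] := @zmodClosed_of_set G (range (tree_eval s h)).
- by exists (GenTree.Node 0 [::]).
- by move=> _ _ [a _ <-] [b _ <-]; exists (GenTree.Node 0 [:: a; b]).
exists D; split.
- have -> : [set` D] = range (tree_eval s h).
    by apply/seteqP; split => x; move/DP.
  by apply: sub_countable (card_image_le _ _) _; exact: countableP.
- by move=> n; apply/DP; exists (GenTree.Leaf n).
- by move=> n x /DP[a _ <-]; apply/DP; exists (GenTree.Node n.+1 [:: a]).
Qed.


(** * Cardinality and subgroups of countable index *)

(** The point [u] serves as the value outside [A] when an injection is extended to a total
    function. *)
Lemma card_le_inj T U (u : U) (A : set T) (B : set U) :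
  A #<= B <-> exists2 f : T -> U, (forall x, A x -> B (f x)) &
    forall x y, A x -> A y -> f x = f y -> x = y.
Proof.
split=> [/card_leP[f]|[f fB f_inj]].
  have /injfunPex[g gB g_inj] : $|{injfun A >-> B}| by squash (valLR u f).
  by exists g => [//|x y Ax Ay]; apply: g_inj; exact: mem_set.
have /injfunPex[g] : exists2 g : T -> U, set_fun A B g & set_inj A g.
  by exists f => // x y /set_mem Ax /set_mem Ay; exact: f_inj.
exact: inj_card_le.
Qed.

(* An infinite M contains a countably infinite subgroup K, and the cosets of K
   in M absorb countable products, as K `*` D injects into K. *)
Lemma card_le_countable_index (G : zmodType) (M : zmodClosed G) (D : set G) :
    infinite_set [set` M] -> countable D ->
    (forall g, exists2 m, m \in M & D (g - m)) ->
  [set: G] #<= [set` M].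
Proof.
move=> /infiniteP/(card_le_inj 0)[s sM s_inj] Dc GMD.
have [K' [K'c sK' _]] := countable_closure s (fun=> id).
have [||K KP] := @zmodClosed_of_set G [set x | x \in M /\ x \in K'].
- by split; exact: rpred0.
- by move=> x y [? ?] [? ?]; split; exact: rpredB.
have KM x : x \in K -> x \in M by move/KP => [].
have Kc : countable [set` K].
  by apply: sub_countable K'c; apply: subset_card_le => x /KP[].
have Kinf : [set: nat] #<= [set` K].
  apply/(card_le_inj 0); exists s => // n _; apply/KP.
  by split; [exact: sM|exact: sK'].
have /(card_le_inj 0)[phi phiK phi_inj] : [set` K] `*` D #<= [set` K].
  by apply: card_le_trans Kinf; exact: countableX.
(* [r] picks one representative of each coset of [K]. *)
pose r x := xget 0 [set y | x - y \in K].
have rK x : x - r x \in K.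
  by apply: (@xgetI _ 0 [set y | x - y \in K] x); rewrite /= subrr rpred0.
have r_eq x y : x - y \in K -> r x = r y.
  move=> xyK; congr (xget 0 _); apply/seteqP; split => z /= Kz.
    by rewrite -(rpredDl _ xyK) addrA subrK.
  by rewrite -(subrK y x) -addrA rpredD.
have /choice[m mP] : forall g, exists m, m \in M /\ D (g - m).
  by move=> g; have [m] := GMD g; exists m.
have mM g := (mP g).1; have mD g := (mP g).2.
have rM g : r (m g) \in M by rewrite -(rpredBl _ (mM g)) KM.
pose k g := phi (m g - r (m g), g - m g).
have KD g : ([set` K] `*` D) (m g - r (m g), g - m g) by split=> /=.
have kK g : k g \in K by exact: phiK.
(* The [K]-coset of the image determines [r (m g)], hence [k g]; injectivity of [phi] then recovers
   [m g] and [g - m g]. *)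
apply/(card_le_inj 0); exists (fun g => r (m g) + k g).
  by move=> g _ /=; rewrite rpredD// KM.
move=> g h _ _ /= e.
have er : r (m g) = r (m h).
  have rB : r (m g) - r (m h) \in K.
    have -> : r (m g) = r (m h) + k h - k g by rewrite -e addrK.
    by rewrite -[_ + _ - k g]addrA [r _ + _]addrC addrK rpredB.
  apply: r_eq; rewrite -(subrKA (r (m g))) rpredD// -(subrKA (r (m h))) rpredD//.
  by rewrite rpredBC.
have kgh : k g = k h by move: e; rewrite er => /addrI.
have [] := phi_inj _ _ (KD g) (KD h) kgh.
by rewrite er => /addIr -> /addIr.
Qed.

(** * Maximal subgroups and complements of divisible subgroups *)

(** Zorn's lemma gives [M] maximal among the subgroups containing [N] and disjoint from [X]; for [y]
    outside [M], the larger subgroup M + Zy must therefore meet [X]. *)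
Lemma maximal_avoiding (G : zmodType) (N : zmodClosed G) (X : set G) :
    (forall x, x \in N -> ~ X x) ->
  exists M : zmodClosed G, [/\ forall x, x \in N -> x \in M,
    forall x, x \in M -> ~ X x
    & forall y, y \notin M -> exists m (k : int), m \in M /\ X (m + y *~ k)].
Proof.
move=> NX.
(* The empty chain has union set0, which is not a subgroup. *)
pose P := [set A : set G | A = set0 \/ [/\ [set` N] `<=` A,
  forall x y, A x -> A y -> A (x - y) & A `&` X = set0]].
have [F FP Ftot|A [PA Amax]] := @Zorn_bigcup G P.
  have [F0|/set0P[A0 [FA0 A0n]]] := eqVneq (F `\ set0) set0.
    left; apply/seteqP; split => // x [A FA Ax].
    have : (F `\ set0) A by split=> // A0; rewrite A0 in Ax.
    by rewrite F0.
  right; split.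
  - have [//|[NA0 _ _]] := FP _ FA0.
    by move=> x Nx; exists A0 => //; exact: NA0.
  - move=> x y [A FA Ax] [B FB By].
    have [C [FC Cx Cy]] : exists C, [/\ F C, C x & C y].
      by have [AB|BA] := Ftot _ _ FA FB; [exists B|exists A]; split=> //; auto.
    have [C0|[_ CB _]] := FP _ FC; first by rewrite C0 in Cx.
    by exists C => //; exact: CB.
  - apply/seteqP; split=> // x [[A FA Ax] Xx].
    have [A0'|[_ _ AX]] := FP _ FA; first by rewrite A0' in Ax.
    by rewrite -AX; split.
have {PA}[A0|[NA AB AX]] := PA.
  have /Amax[] : A `<` [set` N].
    rewrite A0; split=> // /(_ 0); apply; exact: rpred0.
  right; split=> //; first by move=> x y; exact: rpredB.
  by apply/seteqP; split=> // x [/NX].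
have [|//|M MP] := @zmodClosed_of_set G A; first by apply: NA; exact: rpred0.
exists M; split.
- by move=> x /NA /MP.
- by move=> x /MP Ax Xx; have : (A `&` X) x by []; rewrite AX.
move=> y yM; apply: contrapT => noX.
have /Amax[] : A `<` [set z | exists m (k : int), m \in M /\ z = m + y *~ k].
  split=> [z Az|/(_ y) Ay].
    by exists z, 0; rewrite mulr0z addr0; split=> //; apply/MP.
  move/negP: yM; apply; apply/MP/Ay; exists 0, 1.
  by rewrite add0r mulr1z; split=> //; exact: rpred0.
right; split.
- move=> z /NA/MP Mz; exists z, 0; rewrite mulr0z addr0; split=> //.
- move=> _ _ [m [k [mM ->]]] [n [l [nM ->]]]; exists (m - n), (k - l).
  by rewrite mulrzBr opprD addrACA; split=> //; exact: rpredB.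
- by apply/seteqP; split=> // z [[m [k [mM ->]]] Xz]; apply: noX; exists m, k.
Qed.

(* A subgroup maximal among those meeting a divisible D trivially is a
   complement of D. *)
Lemma divisible_complement (G : zmodType) (D : zmodClosed G) :
    (forall n x, x \in D -> exists2 y, y \in D & y *+ n.+1 = x) ->
  exists M : zmodClosed G, (forall x, x \in M -> x \in D -> x = 0) /\
    forall g, exists2 m, m \in M & g - m \in D.
Proof.
move=> Ddiv.
have [||N NP] := @zmodClosed_of_set G [set 0].
- by [].
- by move=> _ _ -> ->; rewrite subr0.
have [|M [_ MX Mmax]] := @maximal_avoiding G N [set x | x \in D /\ x != 0].
  by move=> x /NP -> [_ /eqP].
have MD0 x : x \in M -> x \in D -> x = 0.
  by move=> Mx Dx; apply: contrapT => /eqP x0; exact: (MX x).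
exists M; split=> // y.
have [||S SP] := @zmodClosed_of_set G [set g | exists2 m, m \in M & g - m \in D].
- by exists 0; rewrite ?subr0 rpred0.
- move=> g h [m Mm Dm] [n Mn Dn]; exists (m - n); first exact: rpredB.
  by rewrite opprD addrACA -opprD rpredB.
have MS m : m \in M -> m \in S.
  by move=> Mm; apply/SP; exists m => //; rewrite subrr rpred0.
have DS d : d \in D -> d \in S.
  by move=> Dd; apply/SP; exists 0; rewrite ?rpred0 ?subr0.
apply/SP; apply: contrapT => /negP yS.
have yM : y \notin M by apply: contra yS; exact: MS.
(* Maximality puts some [y *~ k] in [S], that is, in M + D, and [k] is nonzero because [M] and [D]
   meet trivially. *)
have /ex_minnP[n] : exists n, (0 < n)%N && (y *+ n \in S).
  have [m [k [Mm [Dd /eqP d0]]]] := Mmax _ yM.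
  have kS : y *~ k \in S by rewrite -(rpredDl _ (MS _ Mm)) DS.
  exists `|k|%N; rewrite absz_gt0; apply/andP; split.
    apply/eqP => k0; apply: d0; apply: MD0 => //.
    by rewrite k0 mulr0z addr0.
  by rewrite pmulrn; case: k {Dd d0} kS => k //=; rewrite NegzE mulrNz rpredN.
case: n => [|n] //= ynS nmin.
have /SP[m Mm /(Ddiv n)[d Dd dE]] := ynS.
(* By the choice of [d], [(y - d) *+ n.+1] is [m]. Maximality at [y - d] yields a nonzero element
   [m' + (y - d) *~ k] of [D]; minimality makes [n.+1] divide [k], so this element also lies in
   [M]. *)
have yd : y - d \notin S by rewrite rpredBr// DS.
have [|m' [k [Mm' [Dd' /eqP d0]]]] := Mmax (y - d).
  by apply: contra yd; exact: MS.
have kS : (y - d) *~ k \in S by rewrite -(rpredDl _ (MS _ Mm')) DS.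
apply: d0; apply: MD0 => //; rewrite rpredD// (divz_eq k n.+1).
have -> : (k %% n.+1)%Z = 0.
  apply: contrapT => /eqP r0; have : (n.+1 <= `|(k %% n.+1)%Z|)%N.
    apply: nmin; rewrite absz_gt0 r0 /=.
    rewrite pmulrn gez0_abs ?modz_ge0//.
    have yk : y *~ k \in S by move: kS; rewrite mulrzBl rpredBr// rpredMz// DS.
    move: yk; rewrite {1}(divz_eq k n.+1) mulrzDr mulrC mulrzA rpredDl//.
    exact: rpredMz.
  have n0 : n.+1%:Z != 0 by [].
  by have := ltz_mod k n0; have := modz_ge0 k n0; lia.
by rewrite addr0 mulrC mulrzA rpredMz//= -pmulrn mulrnBl dE subKr.
Qed.

(** * Groups whose proper subgroups are all smaller *)

Lemma sumset_setT (G : zmodType) (M : zmodClosed G) (D : set G) :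
    (forall g, exists2 m, m \in M & D (g - m)) ->
  [set: G] `<=` (fun u => u.1 + u.2) @` ([set` M] `*` D).
Proof.
move=> GMD g _; have [m Mm Dm] := GMD g.
by exists (m, g - m); rewrite //= addrC subrK.
Qed.

(* [#<=] suffices: a subgroup H always satisfies [set` H] #<= [set: G]. *)
Definition jonsson (G : zmodType) :=
  forall H : zmodClosed G, [set: G] #<= [set` H] -> forall x, x \in H.

Lemma jonsson_prime_divisible (G : zmodType) (p : nat) :
    infinite_set [set: G] -> jonsson G -> prime p ->
  forall x : G, exists y, y *+ p = x.
Proof.
move=> Ginf J p_pr x; apply: contrapT => xp.
have [||N NP] := @zmodClosed_of_set G (range (fun y : G => y *+ p)).
- by exists 0; rewrite // mul0rn.
- by move=> _ _ [y _ <-] [z _ <-]; exists (y - z); rewrite // mulrnBl.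
have [|M [NM MX Mmax]] := @maximal_avoiding G N [set x].
  by move=> _ /NP[y _ <-] e; apply: xp; exists y.
have xM : x \notin M by apply/negP => /MX; apply.
have Mp y : y *+ p \in M by apply/NM/NP; exists y.
(* M is maximal among the subgroups containing pG and avoiding x, so M has
   index p in G and the multiples of x represent its cosets. *)
pose D := (fun i : nat => x *+ i) @` `I_p.
have Dfin : finite_set D by apply: finite_image; exact: finite_II.
have p0 : p%:Z != 0 by rewrite eqz_nat -lt0n prime_gt0.
have GMD g : exists2 m, m \in M & D (g - m).
  have [gM|gM] := boolP (g \in M).
    by exists g => //; exists 0%N; rewrite ?subrr//= prime_gt0.
  have [m [k [mM /= e]]] := Mmax _ gM.
  (* If [p] divided [k], then [g *~ k] would lie in pG, hence in [M], and so would [x]. *)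
  have pk : coprimez k p.
    rewrite coprimez_sym coprimezE prime_coprime//; apply/negP => pk.
    have /dvdzP[q kE] : (p %| k)%Z by [].
    move/negP: xM; apply; rewrite -e rpredD// kE mulrzA.
    by rewrite -pmulrn.
  (* By Bezout, [g - x *~ u = g *~ (v * p) - m *~ u] is in [M]; reducing [u] modulo [p] changes it
     by a multiple of [x *+ p], also in [M]. *)
  have /coprimezP[[u v] /= uv] := pk.
  have up : (`|(u %% p)%Z| < p)%N.
    by rewrite -ltz_nat gez0_abs ?modz_ge0// ltz_pmod// ltz_nat prime_gt0.
  exists (g - x *+ `|(u %% p)%Z|); last first.
    by rewrite subKr; exists `|(u %% p)%Z|%N.
  have Mpz (z : int) : g *~ (z * p) \in M by rewrite mulrzA -pmulrn.
  have xu : g - x *~ u \in M.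
    have -> : g - x *~ u = g *~ (v * p) - m *~ u.
      have {1}-> : g = g *~ (v * p) + g *~ (u * k).
        by rewrite -mulrzDr addrC uv mulr1z.
      by rewrite -e mulrzDl mulrzA_C [m *~ u + _]addrC addrKA.
    by rewrite rpredB// rpredMz.
  rewrite pmulrn gez0_abs ?modz_ge0//.
  have -> : (u %% p)%Z = u - (u %/ p)%Z * p.
    by rewrite [X in X - _](divz_eq u p) addrAC subrr add0r.
  rewrite mulrzBr opprB addrCA rpredD// mulrzA -pmulrn.
  exact: Mp.
have [Mfin|Minf] := pselect (finite_set [set` M]).
  apply: Ginf; apply: sub_finite_set (sumset_setT GMD) _.
  by apply: finite_image; exact: finite_setX.
move/negP: xM; apply; apply: J; apply: card_le_countable_index GMD => //.
exact: finite_set_countable.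
Qed.

Lemma jonsson_divisible (G : zmodType) (n : nat) :
    infinite_set [set: G] -> jonsson G -> 
  forall x : G, exists y, y *+ n.+1 = x.
Proof.
move=> Ginf J; elim/ltn_ind: n => -[|n] IH x; first by exists x.
have p_pr : prime (pdiv n.+2) by exact: pdiv_prime.
have [y <-] := jonsson_prime_divisible Ginf J p_pr x.
have /dvdnP[[|q] qE] := pdiv_dvd n.+2; first by [].
have [|z <-] := IH q _ y; last by exists z; rewrite -mulrnA -qE.
by rewrite -ltnS qE ltn_Pmulr// prime_gt1.
Qed.

Lemma infinite_neq0 (G : zmodType) :
  infinite_set [set: G] -> exists x : G, x != 0.
Proof.
move=> Ginf; apply: contrapT => noX; apply: Ginf.
apply: sub_finite_set (finite_set1 0) => x _.
by apply: contrapT => /eqP x0; apply: noX; exists x.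
Qed.

Lemma jonsson_countable (G : zmodType) :
    infinite_set [set: G] -> jonsson G -> countable [set: G].
Proof.
move=> Ginf J.
have /choice[h hP] : forall nx : nat * G, exists y, y *+ nx.1.+1 = nx.2.
  by move=> [n x]; exact: jonsson_divisible.
have [x x0] := infinite_neq0 Ginf.
(* Closure under the chosen division [h] makes [D] divisible. *)
have [D [Dc xD hD]] := countable_closure (fun=> x) (fun n y => h (n, y)).
have [|M [MD GMD]] := @divisible_complement G D.
  by move=> n y Dy; exists (h (n, y)); [exact: hD|rewrite hP].
have [Mfin|Minf] := pselect (finite_set [set` M]).
  apply: sub_countable (subset_card_le (sumset_setT GMD)) _.
  apply: sub_countable (card_image_le _ _) _.
  exact: countableX (finite_set_countable Mfin) Dc.
(* An infinite [M] would be all of [G] and contain [x], a nonzero element of [D]. *)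
have /J JM := card_le_countable_index Minf Dc GMD.
by move/eqP: x0; case; apply: MD => //; exact: (xD 0%N).
Qed.

(** As [G] is countable, an infinite subgroup already has the cardinality of [G]. *)
Lemma jonsson_infinite_subgroup (G : zmodType) (H : zmodClosed G) :
    infinite_set [set: G] -> jonsson G -> infinite_set [set` H] ->
  forall x, x \in H.
Proof.
move=> Ginf J /infiniteP Hinf; apply: (J).
exact: card_le_trans (jonsson_countable Ginf J) Hinf.
Qed.

(** An element of infinite order would generate an infinite subgroup, hence [G]; halving [x] there
    gives x = 2kx, so 2k = 1 for an integer k. *)
Lemma jonsson_torsion (G : zmodType) (x : G) :
  infinite_set [set: G] -> jonsson G -> exists n, x *+ n.+1 = 0.
Proof.
move=> Ginf J; apply: contrapT => x_free.
have x_eq0 (k : int) : x *~ k = 0 -> k = 0.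
  case: k => [[|n]|n] //; first by rewrite -pmulrn => xn; case: x_free; exists n.
  rewrite NegzE mulrNz => /eqP; rewrite oppr_eq0 => /eqP xn.
  by case: x_free; exists n.
have [||H HP] := @zmodClosed_of_set G (range (fun k : int => x *~ k)).
- by exists 0; rewrite ?mulr0z.
- by move=> _ _ [a _ <-] [b _ <-]; exists (a - b); rewrite ?mulrzBr.
have [y y2] := @jonsson_divisible G 1 Ginf J x.
have /HP[k _ yE] : y \in H.
  apply: jonsson_infinite_subgroup => //; apply/infiniteP/(card_le_inj 0).
  exists (fun n : nat => x *+ n) => [n _|a b _ _ /eqP].
    by apply/HP; exists (n : int).
  rewrite -subr_eq0 !pmulrn -mulrzBr => /eqP/x_eq0/eqP.
  by rewrite subr_eq0 eqz_nat => /eqP.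
have /x_eq0 : x *~ (k * 2 - 1) = 0.
  by rewrite mulrzBr mulrzA yE mulr1z -pmulrn y2 subrr.
lia.
Qed.

(** If an element has order N > 1 and p is a prime factor of N, its multiple by N/p has order p. *)
Lemma jonsson_prime_order (G : zmodType) :
    infinite_set [set: G] -> jonsson G ->
  exists (p : nat) (x : G), [/\ prime p, x != 0 & x *+ p = 0].
Proof.
move=> Ginf J.
have [x x0] := infinite_neq0 Ginf.
have /ex_minnP[n] : exists n, x *+ n.+1 == 0.
  by have [n xn] := jonsson_torsion x Ginf J; exists n; apply/eqP.
case: n => [|n]; first by rewrite mulr1n (negPf x0).
move=> /eqP xn nmin; have p_pr : prime (pdiv n.+2) by exact: pdiv_prime.
have /dvdnP[[|q] qE] := pdiv_dvd n.+2; first by [].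
exists (pdiv n.+2), (x *+ q.+1); split=> //; last by rewrite -mulrnA -qE.
apply/negP => /nmin; rewrite leqNgt => /negP; apply.
by rewrite -ltnS qE ltn_Pmulr// prime_gt1.
Qed.

(** * Chains under division by p *)

(** [X n] models the class of 1/p^n in Z(p^oo). *)
Definition prufer_chain (G : zmodType) (p : nat) (X : nat -> G) :=
  [/\ X 0%N = 0, X 1%N != 0 & forall n, X n.+1 *+ p = X n].

Section PruferChain.
Variables (G : zmodType) (p : nat) (X : nat -> G).
Hypotheses (p_pr : prime p) (Xchain : prufer_chain p X).

Lemma prufer_chainM n m : X (n + m) *+ p ^ m = X n.
Proof.
have [_ _ XS] := Xchain.
by elim: m => [|m IH]; rewrite ?addn0// addnS expnS mulrnA XS.
Qed.

(** [X n] has order exactly p^n: if [a] kills [X n] with n > 0, then it kills [X 1], so Bezout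
    forces p to divide [a], and a/p kills the preceding term. *)
Lemma prufer_chain_eq0 n (a : int) : (X n *~ a == 0) = ((p ^ n)%N %| a)%Z.
Proof.
have [X0 X1 XS] := Xchain.
apply/eqP/idP; last first.
  move=> /dvdzP[b ->]; rewrite mulrC mulrzA -pmulrn.
  by rewrite -(add0n n) prufer_chainM X0 mul0rz.
elim: n a => [|n IH] a; first by rewrite dvd1z.
move=> Xa; have /dvdzP[b ab] : (p %| a)%Z.
  apply: contrapT => /negP pa; move/eqP: X1; apply.
  have /coprimezP[[u v] /= uv] : coprimez a p.
    by rewrite coprimez_sym coprimezE prime_coprime.
  have X1a : X 1%N *~ a = 0.
    by rewrite -(prufer_chainM 1 n) add1n pmulrn mulrzAC Xa mul0rz.
  rewrite -[X 1%N]mulr1z -uv mulrzDr (mulrC u) (mulrC v) !mulrzA X1a -pmulrn XS X0.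
  by rewrite !mul0rz addr0.
rewrite ab expnSr PoszM dvdz_mul2r ?eqz_nat -?lt0n ?prime_gt0//; apply: IH.
by rewrite -XS pmulrn -mulrzA mulrC -ab.
Qed.

Lemma proper_prufer_finite (H : zmodClosed G) (y : G) :
    (forall g, exists n (a : int), g = X n *~ a) -> y \notin H ->
  finite_set [set` H].
Proof.
move=> Xgen; have [n [a ->]] := Xgen y => yH.
have XH : X n \notin H by apply: contra yH => ?; rewrite rpredMz.
have HX m (b : int) : X m *~ b \in H -> exists c : int, X m *~ b = X n *~ c.
  elim: m b => [|m IH] b Hb.
    by exists 0; have [-> _ _] := Xchain; rewrite mulr0z mul0rz.
  have [mn|nm] := leqP m.+1 n.
    exists ((p ^ (n - m.+1))%N%:Z * b).
    by rewrite mulrzA -pmulrn -{1}(subnKC mn) prufer_chainM.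
  (* Otherwise [b] is invertible modulo the order of [X m.+1], so [H] contains [X m.+1] and its
     multiple [X n]. *)
  have /dvdzP[c bc] : (p %| b)%Z.
    apply: contrapT => /negP pb; move/negP: XH; apply.
    have /coprimezP[[u v] /= uv] : coprimez b (p ^ m.+1)%N.
      by rewrite coprimezE coprimeXr// coprime_sym prime_coprime.
    rewrite -(prufer_chainM n (m.+1 - n)) subnKC 1?ltnW// rpredMn//.
    rewrite -[X m.+1]mulr1z -uv mulrzDr rpredD//.
      by rewrite mulrC mulrzA rpredMz.
    have /eqP -> : X m.+1 *~ (v * (p ^ m.+1)%N) == 0.
      by rewrite prufer_chain_eq0 dvdz_mull.
    exact: rpred0.
  have [_ _ XS] := Xchain.
  have bE : X m.+1 *~ b = X m *~ c by rewrite -(XS m) pmulrn -mulrzA mulrC -bc.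
  by move: Hb; rewrite bE; exact: IH.
have pn0 : (p ^ n)%N%:Z != 0 by rewrite eqz_nat -lt0n expn_gt0 prime_gt0.
apply: sub_finite_set (finite_image (fun i => X n *+ i) (finite_II (p ^ n))).
move=> h Hh; have [m [b hE]] := Xgen h.
have [|c cE] := HX m b; first by rewrite -hE.
exists `|(c %% (p ^ n)%N)%Z|%N => /=.
  by rewrite -ltz_nat gez0_abs ?modz_ge0// ltz_pmod// ltz_nat expn_gt0 prime_gt0.
rewrite hE cE pmulrn gez0_abs ?modz_ge0//; apply/eqP.
rewrite eq_sym -subr_eq0 -mulrzBr prufer_chain_eq0 [X in X - _](divz_eq c (p ^ n)%N).
by rewrite addrK dvdz_mull.
Qed.

End PruferChain.

(** * Z(p^oo) described by generators *)

Definition zinv_pi (p : nat) : {additive zinv p -> Zpoo p} :=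
  \pi_(Quotient.quot (GRing.ZmodClosed.clone (zinv p) (@zinv_int p) _))%qT.

Lemma zinv_pi_eq p (x y : zinv p) :
  zinv_pi p x = zinv_pi p y <-> val x - val y \is a Num.int.
Proof.
pose I : zmodClosed (zinv p) := GRing.ZmodClosed.clone (zinv p) (@zinv_int p) _.
have -> : val x - val y \is a Num.int = (x - y \in I) by rewrite -raddfB.
by rewrite Quotient.idealrBE; split=> /eqP.
Qed.

Lemma zinv_pi_surj p (q : Zpoo p) : exists z, q = zinv_pi p z.
Proof.
by exists (repr (q : Quotient.quot _))%qT; rewrite /zinv_pi /= reprK.
Qed.

Lemma zinv_frac p (n : nat) (a : int) :
  exists z : zinv p, val z = a%:~R / p%:R ^+ n.
Proof.
have Pz : zinv_pred p (a%:~R / p%:R ^+ n) by apply/asboolP; exists a, n.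
by exists (exist (fun x => zinv_pred p x) _ Pz).
Qed.

Lemma zinv_fracP p (z : zinv p) :
  exists na : nat * int, val z = na.2%:~R / p%:R ^+ na.1.
Proof. by have /asboolP[a [n ->]] := valP z; exists (n, a). Qed.

Lemma frac_int p (n : nat) (a : int) : prime p ->
  ((a%:~R / p%:R ^+ n : rat) \is a Num.int) = ((p ^ n)%N %| a)%Z.
Proof.
move=> p_pr; have pn0 : p%:R ^+ n != 0 :> rat.
  by rewrite expf_neq0// pnatr_eq0 -lt0n prime_gt0.
have pE : p%:R ^+ n = (p ^ n)%N%:~R :> rat by rewrite -pmulrn natrX.
apply/intrP/dvdzP => -[m am]; exists m.
  by apply/eqP; rewrite -(eqr_int rat) intrM -pE -am divfK.
by rewrite am intrM -pE mulfK.
Qed.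

(** One direction pulls the classes of 1/p^n back along the isomorphism; the other factors the map
    a/p^n to [X n *~ a] through Z[1/p]/Z. *)
Lemma is_PruferP (G : zmodType) :
  is_Prufer G <-> exists (p : nat) (X : nat -> G), [/\ prime p, prufer_chain p X
    & forall g, exists n (a : int), g = X n *~ a].
Proof.
split=> [[p p_pr [f [g fK gK]]]|[p [X [p_pr Xchain Xgen]]]].
  have /choice[u uE] : forall n, exists z : zinv p, val z = 1%:~R / p%:R ^+ n.
    by move=> n; exact: zinv_frac.
  have f_inj := can_inj fK.
  have f0 z : f z = 0 <-> z = 0.
    by split=> [fz|->]; [apply: f_inj|]; rewrite raddf0.
  have fX n : f (g (zinv_pi p (u n))) = zinv_pi p (u n) by exact: gK.
  exists p, (fun n => g (zinv_pi p (u n))); split=> //; first split.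
  - apply/f0; rewrite fX -(raddf0 (zinv_pi p)); apply/zinv_pi_eq.
    by rewrite raddf0 subr0 uE frac_int// dvd1z.
  - apply/eqP => /f0; rewrite fX -(raddf0 (zinv_pi p)) => /zinv_pi_eq.
    rewrite raddf0 subr0 uE frac_int// expn1 dvdz1.
    by have := prime_gt1 p_pr; lia.
  - move=> n; apply: f_inj; rewrite raddfMn !fX -raddfMn; congr (zinv_pi p _).
    apply: val_inj; rewrite raddfMn/= !uE !mul1r exprSr invfM -[_ / _ *+ _]mulr_natr divfK//.
    by rewrite pnatr_eq0 -lt0n prime_gt0.
  - move=> x; have [z fz] := zinv_pi_surj (f x).
    have [[n a] /= zE] := zinv_fracP z; exists n, a; apply: f_inj.
    rewrite raddfMz fX fz -raddfMz; congr (zinv_pi p _); apply: val_inj.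
    by rewrite raddfMz /= uE zE mul1r -[RHS]mulrzl.
have p0 : p%:R != 0 :> rat by rewrite pnatr_eq0 -lt0n prime_gt0.
have /choice[na naE] := @zinv_fracP p.
(* F sends a / p ^ n to X n *~ a; its kernel is Z. *)
pose F z := X (na z).1 *~ (na z).2.
(* The value does not depend on the chosen fraction: two fractions are compared over the product of
   their denominators. *)
have FE z n (a : int) : val z = a%:~R / p%:R ^+ n -> F z = X n *~ a.
  rewrite naE => /eqP; rewrite eqr_div ?expf_neq0// => /eqP e.
  have {}e : (na z).2 * (p ^ n)%N = a * (p ^ (na z).1)%N.
    by apply/eqP; rewrite -(eqr_int rat) !intrM -!pmulrn !natrX e.
  rewrite /F -(prufer_chainM Xchain (na z).1 n) pmulrn -mulrzA mulrC e.
  by rewrite mulrC mulrzA -pmulrn addnC prufer_chainM.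
have FB x y : F (x - y) = F x - F y.
  have [[n a] xE] := zinv_fracP x; have [[m b] yE] := zinv_fracP y.
  rewrite (FE _ _ _ xE) (FE _ _ _ yE) /=.
  have -> : F (x - y) = X (n + m)%N *~ (a * (p ^ m)%N - b * (p ^ n)%N).
    apply: FE; rewrite raddfB/= xE yE /= -mulNr addf_div ?expf_neq0// -exprD.
    by rewrite mulNr rmorphB !rmorphM/= -!pmulrn !natrX.
  rewrite mulrzBr ![_ * (Posz _)]mulrC !mulrzA -!pmulrn prufer_chainM//.
  by rewrite addnC prufer_chainM.
have F_eq0 x : F x = 0 <-> val x \is a Num.int.
  have [[n a] xE] := zinv_fracP x; rewrite (FE _ _ _ xE) xE/= frac_int//.
  by rewrite -(prufer_chain_eq0 p_pr Xchain); split=> /eqP.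
have F_eq x y : F x = F y <-> zinv_pi p x = zinv_pi p y.
  rewrite zinv_pi_eq -raddfB -F_eq0 FB; split=> [->|/eqP]; first exact: subrr.
  by rewrite subr_eq0 => /eqP.
(* [F] and [zinv_pi p] have the same fibres, so sending [g] to the class of any [F]-preimage is
   additive, with inverse [F] on representatives. *)
have /choice[s sK] : forall g, exists z, F z = g.
  move=> g; have [n [a ->]] := Xgen g; have [z zE] := zinv_frac p n a.
  by exists z; exact: FE.
have fB : zmod_morphism (fun g => zinv_pi p (s g)).
  by move=> g h; rewrite -raddfB; apply/F_eq; rewrite FB !sK.
pose mf := GRing.isZmodMorphism.Build G (Zpoo p) (fun g => zinv_pi p (s g)) fB.
pose f : {additive G -> Zpoo p} := HB.pack (fun g => zinv_pi p (s g)) mf.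
exists p => //; exists f; have /choice[r rK] := @zinv_pi_surj p.
exists (F \o r) => [g|q]; rewrite /= /f/=.
  by rewrite -[RHS]sK; apply/F_eq; rewrite -rK.
by rewrite [RHS]rK; apply/F_eq; rewrite sK.
Qed.

(** * Recognizing Prüfer groups, and the equivalence *)

Lemma jonsson_is_Prufer (G : zmodType) :
  infinite_set [set: G] -> jonsson G -> is_Prufer G.
Proof.
move=> Ginf J; apply/is_PruferP.
have [p [x [p_pr x0 px0]]] := jonsson_prime_order Ginf J.
have /choice[h hK] : forall x : G, exists y, y *+ p = x.
  by move=> y; exact: jonsson_prime_divisible.
(* The shift makes [X 1] equal to [x], whose order [p] matches [X 0 = 0]. *)
pose X n := if n is m.+1 then iter m h x else 0.
have Xchain : prufer_chain p X.
  by split=> // -[|n] //=; rewrite hK.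
exists p, X; split=> //.
have [||H HP] := @zmodClosed_of_set G [set g | exists n (a : int), g = X n *~ a].
- by exists 0%N, 0.
- move=> _ _ [n [a ->]] [m [b ->]].
  exists (n + m)%N, (a * (p ^ m)%N - b * (p ^ n)%N).
  rewrite mulrzBr ![_ * (Posz _)]mulrC !mulrzA -!pmulrn prufer_chainM//.
  by rewrite addnC prufer_chainM.
move=> g; apply/HP; apply: jonsson_infinite_subgroup => //; apply/infiniteP.
apply/(card_le_inj 0); exists X => [n _|n m _ _ e].
  by apply/HP; exists n, 1.
(* Equal terms have equal orders p^n and p^m, so [X] is injective. *)
have div (a : int) : ((p ^ n)%N %| a)%Z = ((p ^ m)%N %| a)%Z.
  by rewrite -!(prufer_chain_eq0 p_pr Xchain) e.
have nm := div (p ^ m)%N; have mn := div (p ^ n)%N.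
rewrite !dvdzE/= !dvdn_Pexp2l ?prime_gt1// !leqnn in nm mn.
by apply/eqP; rewrite eqn_leq nm -mn.
Qed.

Theorem theorem1p1 (G : zmodType) (G_infinite : infinite_set [set: G]) :
  (exists H : zmodClosed G,
     [set` H] `<` [set: G] /\ [set` H] #= [set: G]) <->
  ~ is_Prufer G.
Proof.
split=> [[H [Hproper HG]] /is_PruferP[p [X [p_pr Xchain Xgen]]]|GnP].
  apply: G_infinite; rewrite -(eq_finite_set HG).
  have [y yH] : exists y, y \notin H.
    apply: contrapT => Hall; apply: Hproper.2 => y _ /=.
    by apply: contrapT => /negP yH; apply: Hall; exists y.
  exact: (proper_prufer_finite p_pr Xchain Xgen yH).
apply: contrapT => noH; apply: GnP; apply: jonsson_is_Prufer => // H GH x.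
apply: contrapT => xH; apply: noH; exists H; split.
  by split=> // /(_ x I).
by apply/card_eqPle; split=> //; exact: card_leT.
Qed.
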